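(* Let $W$ be a tournament kernel on a probability space $(\mathcal S,\mu)$. The following are equivalent: (1) $W$ is irreducible; (2) $W$ is strongly connected; (3) there is no measurable $B\subseteq\mathcal S$ with $0<\mu(B)<1$ and $\mu(N(B)\setminus B)=0$; (4) there is no measurable $B\subseteq\mathcal S$ with $0<\mu(B)<1$ and $\int_{B\times\mathcal S}W(x,y)\,d\mu(x)d\mu(y)=\frac{\mu(B)^2}{2}$.
   Context: A tournament kernel on $(\mathcal S,\mu)$ is a measurable $W:\mathcal S^2\to[0,1]$ with $W(x,y)+W(y,x)=1$ for a.e. $(x,y)$. $W$ is reducible if there is a measurable $B$ with $0<\mu(B)<1$ such that $W(x,y)=1$ for a.e. $(x,y)\in B\times(\mathcal S\setminus B)$; otherwise irreducible. For measurable $B$, $N(B)=\{y\in\mathcal S:\int_BW(x,y)\,d\mu(x)>0\}$, $N^1=N$, $N^m(B)=N(N^{m-1}(B))$; for a point $x$, $N(\{x\})=\{y:W(x,y)>0\}$ and $N^m(\{x\})=N^{m-1}(N(\{x\}))$. $W$ is strongly connected if for a.e. $x\in\mathcal S$ the set $A(x)=\bigcup_{i\ge1}N^i(\{x\})$ has $\mu(A(x))=1$. *)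

(* Defs.v *)
From HB Require Import structures.
From mathcomp Require Import all_boot all_order all_algebra.
From mathcomp Require Import all_classical all_reals all_analysis.

Set Implicit Arguments.
Unset Strict Implicit.
Unset Printing Implicit Defensive.

Import Order.TTheory GRing.Theory Num.Theory.

Local Open Scope classical_set_scope.
Local Open Scope ring_scope.

Definition tournament_kernel (d : measure_display) (S : measurableType d)
    (R : realType) (mu : probability S R) (W : S * S -> R) : Prop :=
  [/\ measurable_fun [set: S * S] W,
      forall p, 0 <= W p <= 1 &
      {ae (mu \x mu)%E, forall p, W (p.1, p.2) + W (p.2, p.1) = 1}].

Definition reducible (d : measure_display) (S : measurableType d)
    (R : realType) (mu : probability S R) (W : S * S -> R) : Prop :=
  exists B : set S,
    [/\ measurable B, (0 < mu B < 1)%E &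
        {ae (mu \x mu)%E, forall p, (B `*` ~` B) p -> W p = 1}].

Definition irreducible (d : measure_display) (S : measurableType d)
    (R : realType) (mu : probability S R) (W : S * S -> R) : Prop :=
  ~ reducible mu W.

Definition out_set (d : measure_display) (S : measurableType d)
    (R : realType) (mu : probability S R) (W : S * S -> R)
    (B : set S) : set S :=
  [set y | (0 < \int[mu]_(x in B) (W (x, y))%:E)%E].

(* The out-neighbourhood of a point is defined pointwise; it is not
   [out_set mu W [set x]], which is empty when [set x] is a null set. *)
Definition out_pt (d : measure_display) (S : measurableType d)
    (R : realType) (W : S * S -> R) (x : S) : set S :=
  [set y | 0 < W (x, y)].

(* N^m({x}) = N^(m-1)(N({x})), meaningful for m >= 1 only. *)
Definition out_pt_iter (d : measure_display) (S : measurableType d)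
    (R : realType) (mu : probability S R) (W : S * S -> R)
    (m : nat) (x : S) : set S :=
  iter m.-1 (out_set mu W) (out_pt W x).

Definition reachable (d : measure_display) (S : measurableType d)
    (R : realType) (mu : probability S R) (W : S * S -> R) (x : S) : set S :=
  \bigcup_(i in [set i | (1 <= i)%N]) out_pt_iter mu W i x.

Definition strongly_connected (d : measure_display) (S : measurableType d)
    (R : realType) (mu : probability S R) (W : S * S -> R) : Prop :=
  {ae mu, forall x, mu (reachable mu W x) = 1%E}.

(* Main.v *)
Require Import Defs.
From HB Require Import structures.
From mathcomp Require Import all_boot all_order all_algebra.
From mathcomp Require Import all_classical all_reals all_analysis.
From mathcomp Require Import measurable_realfun lra.

Set Implicit Arguments.
Unset Strict Implicit.
Unset Printing Implicit Defensive.

Import Order.TTheory GRing.Theory Num.Theory.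

Local Open Scope classical_set_scope.
Local Open Scope ring_scope.

(** Let [flow A C] be the integral of [W] over [A `*` C].  The tournament
    identity gives [flow A C + flow C A = mu A * mu C]; in particular
    [flow B B = mu B ^+ 2 / 2].  Hence each of the sets [B] excluded in (1), (3)
    and (4) exists iff there is an absorbing set, i.e. some [B] with
    [0 < mu B < 1] and no flow to its complement (for (1), up to exchanging [B]
    and its complement).

    Up to null sets, almost every point of an absorbing [B] only reaches points
    of [B].  Conversely [reachable mu W x] contains its out-neighbourhood, so it
    has no flow to its complement; if nothing is absorbing, its measure is 0 or
    1, and 0 is excluded for almost every [x], since the set [Z] of points with
    null out-neighbourhood satisfies [mu Z ^+ 2 / 2 = flow Z Z = 0]. *)

Lemma ge0_integral_eq0P d (T : measurableType d) (R : realType)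
    (mu : {measure set T -> \bar R}) (D : set T) (f : T -> \bar R) :
  measurable D -> measurable_fun D f -> (forall x, 0 <= f x)%E ->
  (\int[mu]_(x in D) f x = 0)%E <->
  mu.-negligible (D `&` [set x | (0 < f x)%E]).
Proof.
move=> mD mf f0.
have -> : D `&` [set x | (0 < f x)%E] = ~` [set x | D x -> f x = 0%E].
  apply/seteqP; split => x /=.
    by move=> [Dx fx]; apply/not_implyP; split => //; apply/eqP; rewrite gt_eqF.
  by move=> /not_implyP[Dx /eqP fx]; rewrite lt0e fx f0.
rewrite (eq_integral (fun x => `|f x|%E)); last by move=> x _; rewrite gee0_abs.
exact: ae_eq_integral_abs.
Qed.

Section probability.
Local Open Scope ereal_scope.
Context d (T : measurableType d) (R : realType) (P : probability T R).

Lemma probability_eq1_negligibleD (A B : set T) :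
  measurable A -> measurable B -> P A = 1 -> P.-negligible (A `\` B) -> P B = 1.
Proof.
move=> mA mB PA /negligibleP AB0; apply/eqP.
rewrite eq_le probability_le1//= -PA (measureDI P mA mB).
rewrite [X in X + _]AB0 ?add0e; last exact: measurableD.
by apply: le_measure; rewrite ?inE//; exact: measurableI.
Qed.

Lemma probability_setC_gt0_lt1 (A : set T) :
  measurable A -> 0 < P A < 1 -> 0 < P (~` A) < 1.
Proof.
move=> mA; have /fineK : P A \is a fin_num by exact: fin_num_measure.
rewrite probability_setC// => <-.
by rewrite -EFinB !lte_fin => /andP[? ?]; apply/andP; split; lra.
Qed.

End probability.

Section tonelli_rectangles.
Local Open Scope ereal_scope.
Context d1 d2 (T1 : measurableType d1) (T2 : measurableType d2) (R : realType).
Variable m1 : {sigma_finite_measure set T1 -> \bar R}.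
Variable m2 : {sigma_finite_measure set T2 -> \bar R}.
Variable f : T1 * T2 -> \bar R.

Lemma fubini_F_patch (A : set T1) (B : set T2) :
  fubini_F m2 (f \_ (A `*` B)) = (fun x => \int[m2]_(y in B) f (x, y)) \_ A.
Proof.
apply/funext => x; rewrite /fubini_F patchE; case: ifPn => xA.
  rewrite [RHS]integral_mkcond; apply: eq_integral => y _.
  by rewrite !patchE in_setX xA.
by apply: integral0_eq => y _; rewrite patchE in_setX (negbTE xA).
Qed.

Lemma fubini_G_patch (A : set T1) (B : set T2) :
  fubini_G m1 (f \_ (A `*` B)) = (fun y => \int[m1]_(x in A) f (x, y)) \_ B.
Proof.
apply/funext => y; rewrite /fubini_G patchE; case: ifPn => yB.
  rewrite [RHS]integral_mkcond; apply: eq_integral => x _.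
  by rewrite !patchE in_setX yB andbT.
by apply: integral0_eq => x _; rewrite patchE in_setX (negbTE yB) andbF.
Qed.

Hypothesis mf : measurable_fun setT f.
Hypothesis f0 : forall p, 0 <= f p.

Let measurable_patch_setX (A : set T1) (B : set T2) :
  measurable A -> measurable B -> measurable_fun setT (f \_ (A `*` B)).
Proof.
move=> mA mB; apply/(measurable_restrictT _ _).1; first exact: measurableX.
exact: measurable_funTS.
Qed.

Let patch_setX_ge0 (A : set T1) (B : set T2) p : 0 <= (f \_ (A `*` B)) p.
Proof. by rewrite patchE; case: ifP. Qed.

Lemma measurable_fun_integral_xsection (B : set T2) : measurable B ->
  measurable_fun setT (fun x => \int[m2]_(y in B) f (x, y)).
Proof.
move=> mB; apply/(measurable_restrictT _ measurableT); rewrite -fubini_F_patch.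
by apply: measurable_fun_fubini_tonelli_F => //; exact: measurable_patch_setX.
Qed.

Lemma measurable_fun_integral_ysection (A : set T1) : measurable A ->
  measurable_fun setT (fun y => \int[m1]_(x in A) f (x, y)).
Proof.
move=> mA; apply/(measurable_restrictT _ measurableT); rewrite -fubini_G_patch.
by apply: measurable_fun_fubini_tonelli_G => //; exact: measurable_patch_setX.
Qed.

Variables (A : set T1) (B : set T2).
Hypotheses (mA : measurable A) (mB : measurable B).

Lemma ge0_integral_setX1 :
  \int[m1 \x m2]_(p in A `*` B) f p =
  \int[m1]_(x in A) \int[m2]_(y in B) f (x, y).
Proof.
rewrite integral_mkcond fubini_tonelli1//; last exact: measurable_patch_setX.
by rewrite fubini_F_patch -integral_mkcond.
Qed.

Lemma ge0_integral_setX2 :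
  \int[m1 \x m2]_(p in A `*` B) f p =
  \int[m2]_(y in B) \int[m1]_(x in A) f (x, y).
Proof.
rewrite integral_mkcond fubini_tonelli2//; last exact: measurable_patch_setX.
by rewrite fubini_G_patch -integral_mkcond.
Qed.

End tonelli_rectangles.

Lemma ge0_integral_setX_swap d1 d2 (T1 : measurableType d1)
    (T2 : measurableType d2) (R : realType)
    (m1 : {sigma_finite_measure set T1 -> \bar R})
    (m2 : {sigma_finite_measure set T2 -> \bar R}) (f : T1 * T2 -> \bar R)
    (A : set T1) (B : set T2) :
  measurable_fun setT f -> (forall p, (0 <= f p)%E) ->
  measurable A -> measurable B ->
  (\int[m2 \x m1]_(p in B `*` A) f (p.2, p.1) =
   \int[m1 \x m2]_(p in A `*` B) f p)%E.
Proof.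
move=> mf f0 mA mB; rewrite ge0_integral_setX1//=.
- by rewrite ge0_integral_setX2.
- by apply: (measurableT_comp mf); exact: measurable_swap.
Qed.

Section nonnegative_kernel.
Context d (S : measurableType d) (R : realType).
Variables (mu : probability S R) (W : S * S -> R).
Local Open Scope ereal_scope.

Definition flow (A C : set S) := \int[mu \x mu]_(p in A `*` C) (W p)%:E.

Definition absorbing (B : set S) :=
  [/\ measurable B, 0 < mu B < 1 & flow B (~` B) = 0].

Definition in_pt (y : S) : set S := [set x | (0 < W (x, y))%R].

Hypothesis mW : measurable_fun setT W.
Hypothesis W_ge0 : forall p, (0 <= W p)%R.

Let mEW : measurable_fun setT (fun p => (W p)%:E).
Proof. exact/measurable_EFinP. Qed.

Let EW_ge0 p : 0 <= (W p)%:E.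
Proof. by rewrite lee_fin. Qed.

Lemma flow_setTr A B : measurable A -> measurable B ->
  flow A setT = flow A B + flow A (~` B).
Proof.
move=> mA mB; have mCB := measurableC mB.
rewrite {1}/flow (_ : A `*` setT = A `*` B `|` A `*` ~` B); last first.
  apply/seteqP; split=> -[x y] /=; last by move=> [[]|[]].
  by move=> [Ax _]; have [By|nBy] := pselect (B y); [left|right].
apply: ge0_integral_setU => //; try exact: measurableX.
- exact: measurable_funTS.
- by apply/eqP/seteqP; split => // -[x y] /= [[_ By] [_ nBy]].
Qed.

Lemma out_setP B y : measurable B ->
  out_set mu W B y <-> ~ mu.-negligible (B `&` in_pt y).
Proof.
move=> mB; have mWy : measurable_fun B (fun x => (W (x, y))%:E).
  by apply: measurable_funTS; exact: measurableT_comp mEW (measurable_pair2 y).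
have := ge0_integral_eq0P mu mB mWy (fun=> EW_ge0 _).
under [[set x | _]]eq_set do rewrite lte_fin.
move=> <-; rewrite /out_set/= lt0e integral_ge0// andbT.
by split => /eqP.
Qed.

Lemma negligible_out_ptP C x : measurable C ->
  mu.-negligible (out_pt W x `&` C) <-> \int[mu]_(y in C) (W (x, y))%:E = 0.
Proof.
move=> mC; have mWx : measurable_fun C (fun y => (W (x, y))%:E).
  by apply: measurable_funTS; exact: measurableT_comp mEW (measurable_pair1 x).
rewrite (ge0_integral_eq0P mu mC mWx (fun=> EW_ge0 _)).
by under [[set y | _]]eq_set do rewrite lte_fin; rewrite setIC.
Qed.

Lemma flow_eq0_out_set A C : measurable A -> measurable C ->
  flow A C = 0 <-> mu.-negligible (out_set mu W A `&` C).
Proof.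
move=> mA mC; rewrite /flow (ge0_integral_setX2 mu mu mEW)// setIC.
apply: ge0_integral_eq0P => //.
- by apply: measurable_funTS; exact: (measurable_fun_integral_ysection mu mEW).
- by move=> y; exact: integral_ge0.
Qed.

Lemma flow_eq0_out_pt A C : measurable A -> measurable C ->
  flow A C = 0 <->
  {ae mu, forall x, A x -> mu.-negligible (out_pt W x `&` C)}.
Proof.
move=> mA mC; rewrite /flow (ge0_integral_setX1 mu mu mEW)//.
rewrite (eq_integral (fun x => `|\int[mu]_(y in C) (W (x, y))%:E|)); last first.
  by move=> x _; rewrite gee0_abs// integral_ge0.
have mWC : measurable_fun A (fun x => \int[mu]_(y in C) (W (x, y))%:E).
  by apply: measurable_funTS; exact: (measurable_fun_integral_xsection mu mEW).
rewrite (ae_eq_integral_abs mu mA mWC).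
by split; apply: filterS => x + Ax => /(_ Ax) /(negligible_out_ptP x mC).
Qed.

Lemma measurable_out_set B : measurable B -> measurable (out_set mu W B).
Proof.
move=> mB; rewrite -[X in measurable X]setTI.
apply: emeasurable_fun_o_infty => //.
exact: (measurable_fun_integral_ysection mu mEW).
Qed.

Lemma measurable_out_pt x : measurable (out_pt W x).
Proof.
have := measurableT_comp mEW (measurable_pair1 x).
move=> /(emeasurable_fun_o_infty measurableT)/(_ 0); rewrite setTI/=.
by under eq_set do rewrite lte_fin.
Qed.

Lemma flow_setC_eq0P B : measurable B ->
  flow B (~` B) = 0 <-> mu (out_set mu W B `\` B) = 0.
Proof.
move=> mB; rewrite flow_eq0_out_set//; last exact: measurableC.
rewrite -setDE negligibleP//.
by apply: measurableD => //; exact: measurable_out_set.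
Qed.

Lemma out_set_negligibleS A B : measurable A -> measurable B ->
  mu.-negligible (A `\` B) -> out_set mu W A `<=` out_set mu W B.
Proof.
move=> mA mB AB y /(out_setP _ mA) yA; apply/(out_setP _ mB) => yB; apply: yA.
apply: negligibleS (negligibleU AB yB) => x [Ax xy].
by have [Bx|nBx] := pselect (B x); [right|left].
Qed.

Lemma out_set_bigcup (F : (set S)^nat) : (forall n, measurable (F n)) ->
  out_set mu W (\bigcup_n F n) = \bigcup_n out_set mu W (F n).
Proof.
move=> mF; have mUF : measurable (\bigcup_n F n) by exact: bigcupT_measurable.
apply/seteqP; split => [y /(out_setP _ mUF)|].
  rewrite setI_bigcupl => yF; apply: contrapT => nFy; apply: yF.
  apply: negligible_bigcup => n; apply: contrapT => /(out_setP _ (mF n)) Fny.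
  by apply: nFy; exists n.
apply: bigcup_sub => n _; apply: out_set_negligibleS => //.
rewrite (_ : _ `\` _ = set0); first exact: negligible_set0.
by rewrite setD_eq0; exact: bigcup_sup.
Qed.

Lemma reachableE x :
  reachable mu W x = \bigcup_n iter n (out_set mu W) (out_pt W x).
Proof.
apply/seteqP; split => y [n /= n1 yn]; first by exists n.-1.
by exists n.+1.
Qed.

Lemma measurable_iter_out_set n x :
  measurable (iter n (out_set mu W) (out_pt W x)).
Proof.
by elim: n => [|n IH]; [exact: measurable_out_pt|exact: measurable_out_set].
Qed.

Lemma measurable_reachable x : measurable (reachable mu W x).
Proof.
rewrite reachableE; apply: bigcupT_measurable => n.
exact: measurable_iter_out_set.
Qed.

Lemma out_pt_reachable x : out_pt W x `<=` reachable mu W x.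
Proof. by rewrite reachableE => y xy; exists 0%N. Qed.

Lemma out_set_reachable x :
  out_set mu W (reachable mu W x) `<=` reachable mu W x.
Proof.
rewrite reachableE out_set_bigcup; last first.
  by move=> n; exact: measurable_iter_out_set.
by apply: bigcup_sub => n _ y yn; exists n.+1.
Qed.

Lemma flow_reachable x : flow (reachable mu W x) (~` reachable mu W x) = 0.
Proof.
apply/(flow_setC_eq0P (measurable_reachable x)).
by have := @out_set_reachable x; rewrite -setD_eq0 => ->; rewrite measure0.
Qed.

Lemma negligible_reachableD B x : measurable B -> flow B (~` B) = 0 ->
  mu.-negligible (out_pt W x `\` B) -> mu.-negligible (reachable mu W x `\` B).
Proof.
move=> mB /(flow_eq0_out_set mB (measurableC mB)); rewrite -setDE => NB xB.
rewrite reachableE setDE setI_bigcupl; apply: negligible_bigcup => n.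
rewrite -setDE; elim: n => //= n IH; apply: negligibleS NB; apply: setSD.
by apply: out_set_negligibleS => //; exact: measurable_iter_out_set.
Qed.

Lemma strongly_connected_not_absorbing B :
  strongly_connected mu W -> ~ absorbing B.
Proof.
move=> sc [mB /andP[B_gt0 B_lt1] B_closed].
have /(flow_eq0_out_pt mB (measurableC mB)) out_B := B_closed.
suff /negligibleP -/(_ mB) B0 : mu.-negligible B by rewrite B0 ltxx in B_gt0.
have : {ae mu, forall x, ~ B x}.
  apply: filterS2 sc out_B => x reach_x out_x /out_x.
  rewrite -setDE => /(negligible_reachableD mB B_closed) reachB.
  have mR := measurable_reachable x.
  by rewrite (probability_eq1_negligibleD mR mB reach_x reachB) ltxx in B_lt1.
by apply: negligibleS => x Bx; exact.
Qed.

End nonnegative_kernel.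

Section tournament_kernel.
Context d (S : measurableType d) (R : realType).
Variables (mu : probability S R) (W : S * S -> R).
Hypothesis hW : tournament_kernel mu W.
Local Open Scope ereal_scope.

Let mW : measurable_fun setT W. Proof. by case: hW. Qed.

Let W_ge0 p : (0 <= W p)%R.
Proof. by case: hW => _ /(_ p)/andP[]. Qed.

Let mEW : measurable_fun setT (fun p => (W p)%:E).
Proof. exact/measurable_EFinP. Qed.

Let EW_ge0 p : 0 <= (W p)%:E.
Proof. by rewrite lee_fin. Qed.

Let mEW_swap : measurable_fun setT (fun p => (W (p.2, p.1))%:E).
Proof. by apply: (measurableT_comp mEW); exact: measurable_swap. Qed.

Lemma flow_swap A C : measurable A -> measurable C ->
  \int[mu \x mu]_(p in A `*` C) (W (p.2, p.1))%:E = flow mu W C A.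
Proof. by move=> mA mC; exact: (ge0_integral_setX_swap mu mu mEW). Qed.

Lemma flowD A C : measurable A -> measurable C ->
  flow mu W A C + flow mu W C A = mu A * mu C.
Proof.
move=> mA mC; have mAC : measurable (A `*` C) by exact: measurableX.
rewrite -(flow_swap mA mC) /flow -ge0_integralD//; first last.
- exact: measurable_funTS.
- exact: measurable_funTS.
rewrite (ge0_ae_eq_integral (g := cst 1))//.
- by rewrite integral_cst// mul1e; exact: product_measure1E.
- by apply: emeasurable_funD; exact: measurable_funTS.
- by move=> p _; rewrite adde_ge0.
- case: hW => _ _; apply: filterS => -[x y] /= Wxy _.
  by rewrite -EFinD Wxy.
Qed.

Lemma flow_fin_num A C :
  measurable A -> measurable C -> flow mu W A C \is a fin_num.
Proof.
move=> mA mC; have : mu A * mu C \is a fin_num.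
  by rewrite fin_numM// fin_num_measure.
by rewrite -flowD// fin_numD => /andP[].
Qed.

Lemma flow_diag B : measurable B -> flow mu W B B = mu B ^+ 2 * (2^-1)%:E.
Proof.
move=> mB; have := flowD mB mB.
have /fineK <- := flow_fin_num mB mB.
have /fineK <- : mu B \is a fin_num by exact: fin_num_measure.
by rewrite expe2 -!EFinM -EFinD => -[BB]; congr _%:E; lra.
Qed.

Lemma flow_setT_halfP B : measurable B ->
  flow mu W B setT = mu B ^+ 2 * (2^-1)%:E <-> flow mu W B (~` B) = 0.
Proof.
move=> mB; have mCB := measurableC mB; rewrite -flow_diag//.
rewrite (flow_setTr mu mW W_ge0 mB mB).
have /fineK <- := flow_fin_num mB mB.
have /fineK <- := flow_fin_num mB mCB.
by rewrite -EFinD; split => -[] h; congr _%:E; lra.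
Qed.

Lemma ae_eq1_flow_eq0 A C : measurable A -> measurable C ->
  {ae (mu \x mu), forall p, (A `*` C) p -> W p = 1%R} <-> flow mu W C A = 0.
Proof.
move=> mA mC; have mAC : measurable (A `*` C) by exact: measurableX.
rewrite -flow_swap// (eq_integral (fun p => `|(W (p.2, p.1))%:E|)); last first.
  by move=> p _; rewrite gee0_abs// lee_fin.
rewrite (ae_eq_integral_abs (mu \x mu) mAC (measurable_funTS mEW_swap)).
case: hW => _ _ W1.
split; apply: filterS2 W1 => -[x y] /= Wxy + ACxy => /(_ ACxy).
- by move=> Wxy1; congr _%:E; lra.
- by move=> -[Wyx0]; lra.
Qed.

Lemma reducibleP : reducible mu W <-> exists B, absorbing mu W B.
Proof.
split=> -[B [mB B01 hB]]; exists (~` B); have mCB := measurableC mB;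
  (split; [exact: mCB|exact: probability_setC_gt0_lt1|]);
  by rewrite setCK; exact/ae_eq1_flow_eq0.
Qed.

Lemma out_pt_nonnegligible_ae :
  {ae mu, forall x, ~ mu.-negligible (out_pt W x)}.
Proof.
pose Z := [set x | \int[mu]_y (W (x, y))%:E = 0].
have ZP x : mu.-negligible (out_pt W x) <-> Z x.
  by have := negligible_out_ptP mu mW W_ge0 x measurableT; rewrite setIT.
have mZ : measurable Z.
  have mZf := measurable_fun_integral_xsection mu mEW EW_ge0 measurableT.
  by rewrite -[Z]setTI; exact: (mZf measurableT _ (emeasurable_set1 0)).
have flowZ : flow mu W Z Z = 0.
  apply/flow_eq0_out_pt => //; apply: aeW => x /ZP; apply: negligibleS.
  exact: subIsetl.
exists Z; split => //; last by move=> x /contrapT /ZP.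
have := flowD mZ mZ; rewrite flowZ adde0 => /esym/eqP.
by rewrite mule_eq0 orbb => /eqP.
Qed.

Lemma not_absorbing_strongly_connected :
  ~ (exists B, absorbing mu W B) -> strongly_connected mu W.
Proof.
move=> no_abs; apply: filterS out_pt_nonnegligible_ae => x out_x.
have mR := measurable_reachable mu mW W_ge0 x.
apply/eqP; rewrite eq_le probability_le1//= leNgt; apply/negP => R_lt1.
apply: no_abs; exists (reachable mu W x).
split => //; last exact: flow_reachable.
rewrite R_lt1 andbT lt0e measure_ge0 andbT; apply/eqP => R0; apply: out_x.
exact/(negligibleS (@out_pt_reachable _ _ _ mu W x))/negligibleP.
Qed.

End tournament_kernel.

Theorem theorem8p2 (d : measure_display) (S : measurableType d)
    (R : realType) (mu : probability S R) (W : S * S -> R)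
    (hW : tournament_kernel mu W) :
  [<-> irreducible mu W;
       strongly_connected mu W;
       ~ (exists B : set S,
            [/\ measurable B, (0 < mu B < 1)%E &
                mu (out_set mu W B `\` B) = 0%E]);
       ~ (exists B : set S,
            [/\ measurable B, (0 < mu B < 1)%E &
                (\int[(mu \x mu)%E]_(p in B `*` [set: S]) (W p)%:E
                 = mu B ^+ 2 * (2^-1)%:E)%E])].
Proof.
have [mW W01 _] := hW; have W_ge0 p : 0 <= W p by have /andP[] := W01 p.
tfae.
- move=> irr; apply: (not_absorbing_strongly_connected hW).
  by move=> /(reducibleP hW).
- move=> sc [B [mB B01 NB]].
  apply: (strongly_connected_not_absorbing mW W_ge0 sc).
  by split; [exact: mB| |exact/flow_setC_eq0P].
- apply: contra_not => -[B [mB B01 hB]]; exists B; split => //.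
  exact/(flow_setC_eq0P mu mW W_ge0 mB)/(flow_setT_halfP hW mB).
- apply: contra_not => /(reducibleP hW)[B [mB B01 hB]]; exists B; split => //.
  exact/(flow_setT_halfP hW mB).
Qed.
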